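(* Let $(X,\{\alpha_i\},Y,\{h_i\})$ be a root datum of finite type, let $\pi\subset X^+$ be a finite saturated set, and let $\{H_1,\dots,H_n\}$ be any $\mathbb{Q}$-basis of $\mathbb{Q}\otimes_{\mathbb{Z}}Y\subset\mathfrak{g}$. Let $P_{W\pi}=\{(\langle H_1,\lambda\rangle,\dots,\langle H_n,\lambda\rangle)\mid\lambda\in W\pi\}\subset\mathbb{A}^n_{\mathbb{Q}}$ and let $I(P_{W\pi})\subset\mathbb{Q}[H_1,\dots,H_n]\simeq\mathfrak{U}^0$ be its vanishing ideal. Then the defining ideal $\Lambda$ of the generalized Schur algebra $S(\pi)=\mathfrak{U}/\Lambda$ is the two-sided ideal of $\mathfrak{U}$ generated by $I(P_{W\pi})$. In particular, $\Lambda$ is generated (as a two-sided ideal) by its intersection with $\mathfrak{U}^0$.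
   Context: **Root datum.** A Cartan datum is a finite set $I$ with a symmetric $\mathbb{Z}$-valued bilinear form $(\ ,\ )$ on $\mathbb{Z}[I]$ such that $(i,i)\in\{2,4,6,\dots\}$ for $i\in I$ and $2(i,j)/(i,i)\in\{0,-1,-2,\dots\}$ for $i\ne j$. It is of finite type if the matrix $((i,j))_{i,j\in I}$ is positive definite. A root datum associated to it consists of finitely generated free abelian groups $X,Y$, a perfect pairing $\langle\ ,\ \rangle:Y\times X\to\mathbb{Z}$, and embeddings $I\to Y$, $i\mapsto h_i$, and $I\to X$, $i\mapsto\alpha_i$, with $\langle h_i,\alpha_j\rangle=2(i,j)/(i,i)$. The root datum is of finite type if its Cartan datum is. The Weyl group $W$ is generated by $s_i$ ($i\in I$) and acts on $X$ by $s_i(\lambda)=\lambda-\langle h_i,\lambda\rangle\alpha_i$. Write $\lambda\le\lambda'$ if $\lambda'-\lambda\in\sum_i\mathbb{N}\alpha_i$, and $X^+=\{\lambda\in X\mid\langle h_i,\lambda\rangle\in\mathbb{N}\text{ for all }i\}$. A subset $\pi\subset X^+$ is saturated if $\lambda\in\pi$, $\lambda'\in X^+$, $\lambda'\le\lambda$ imply $\lambda'\in\pi$. $W\pi\subset X$ is the union of the $W$-orbits of elements of $\pi$. **Enveloping algebra.** Put $\mathfrak{h}=\mathbb{Q}\otimes_{\mathbb{Z}}Y$ and extend the pairing $\mathbb{Q}$-linearly to $\mathfrak{h}\times X\to\mathbb{Q}$. $\mathfrak{g}$ is the Lie algebra over $\mathbb{Q}$ generated by $\mathfrak{h}$ and $e_i,f_i$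 ($i\in I$) with relations $[h,h']=0$, $[h,e_i]=\langle h,\alpha_i\rangle e_i$, $[h,f_i]=-\langle h,\alpha_i\rangle f_i$, $[e_i,f_j]=\delta_{ij}h_i$, and $(\mathrm{ad}\,e_i)^{1-\langle h_i,\alpha_j\rangle}e_j=0=(\mathrm{ad}\,f_i)^{1-\langle h_i,\alpha_j\rangle}f_j$ for $i\neq j$ ($h,h'\in\mathfrak{h}$, $i,j\in I$). $\mathfrak{U}=\mathfrak{U}(\mathfrak{g})$ is its universal enveloping algebra, and $\mathfrak{U}^0$ is the subalgebra generated by $\mathfrak{h}$, which is the polynomial algebra $\mathbb{Q}[H_1,\dots,H_n]$; it is regarded as the coordinate ring of $\mathbb{A}^n_{\mathbb{Q}}$ with $H_a$ as the coordinate functions. **Generalized Schur algebra.** For a $\mathfrak{U}$-module $V$ and $\lambda\in X$, $V_\lambda=\{m\in V\mid hm=\langle h,\lambda\rangle m\ \forall h\in\mathfrak{h}\}$. $\mathcal{C}$ is the category of $\mathfrak{U}$-modules $V$ with $V=\bigoplus_{\lambda\in X}V_\lambda$, and $\mathcal{C}[\pi]$ is its full subcategory of those $M$ with $M=\bigoplus_{\lambda\in W\pi}M_\lambda$. The defining ideal $\Lambda$ is the ideal of all elements of $\mathfrak{U}$ annihilating every object of $\mathcal{C}[\pi]$, and $S(\pi)=\mathfrak{U}/\Lambda$. *)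

(* Defs.v *)
From HB Require Import structures.
From mathcomp Require Import all_boot all_order all_algebra.
From mathcomp Require Import boolp classical_sets cardinality.
From mathcomp Require Import mpoly.

Set Implicit Arguments.
Unset Strict Implicit.
Unset Printing Implicit Defensive.

Import Order.TTheory GRing.Theory Num.Theory.

Local Open Scope classical_set_scope.
Local Open Scope quotient_scope.
Local Open Scope ring_scope.

Record cartan_datum := CartanDatum {
  cd_index :> finType;
  (* values on the basis of a symmetric bilinear form on the free abelian
     group Z[I] *)
  cd_form : cd_index -> cd_index -> int;
  cd_formC : forall i j, cd_form i j = cd_form j i;
  cd_form_diag : forall i, exists k : nat, cd_form i i = (2 * k.+1)%:Z;
  cd_form_offdiag : forall i j, i != j ->
    exists k : nat,
      2%:Q * (cd_form i j)%:Q / (cd_form i i)%:Q = - (k%:R : rat)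
}.

(* An integer matrix is positive definite over Q iff it is so over the reals. *)
Definition cd_finite_type (C : cartan_datum) : Prop :=
  forall x : C -> rat, (exists i, x i != 0) ->
    0 < \sum_i \sum_j x i * x j * (cd_form i j)%:Q.

Definition fg_free_abelian (Z : zmodType) : Prop :=
  exists (r : nat) (b : 'I_r -> Z),
    forall z, exists! c : 'rV[int]_r, z = \sum_i b i *~ c 0 i.

Record root_datum := RootDatum {
  rd_cartan :> cartan_datum;
  rd_X : zmodType;
  rd_Y : zmodType;
  rd_X_free : fg_free_abelian rd_X;
  rd_Y_free : fg_free_abelian rd_Y;
  rd_pair : rd_Y -> rd_X -> int;
  rd_pairDl : forall x, {morph rd_pair^~ x : y y' / y + y'};
  rd_pairDr : forall y, {morph rd_pair y : x x' / x + x'};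
  rd_perfectl : forall phi : {additive rd_X -> int},
    exists! y, forall x, rd_pair y x = phi x;
  rd_perfectr : forall phi : {additive rd_Y -> int},
    exists! x, forall y, rd_pair y x = phi y;
  rd_coroot : rd_cartan -> rd_Y;
  rd_root : rd_cartan -> rd_X;
  rd_coroot_inj : injective rd_coroot;
  rd_root_inj : injective rd_root;
  rd_pair_coroot_root : forall i j,
    (rd_pair (rd_coroot i) (rd_root j))%:Q
      = 2%:Q * (cd_form i j)%:Q / (cd_form i i)%:Q
}.

Section Weights.

Variable D : root_datum.
Implicit Types (lam mu : rd_X D) (i : D).

Definition rd_refl i lam : rd_X D :=
  lam - rd_root i *~ rd_pair (rd_coroot i) lam.

(* The reflections are involutions, so the monoid they generate is the Weyl
   group; it is given here by its action on X. *)
Inductive weyl : (rd_X D -> rd_X D) -> Prop :=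
| weyl1 : weyl id
| weylM i w : weyl w -> weyl (rd_refl i \o w).

Definition dominance_le lam mu : Prop :=
  exists c : D -> nat, mu - lam = \sum_i rd_root i *+ c i.

Definition dominant : set (rd_X D) :=
  [set lam | forall i, 0 <= rd_pair (rd_coroot i) lam].

Definition saturated (pi : set (rd_X D)) : Prop :=
  pi `<=` dominant /\
  forall lam mu, pi lam -> dominant mu -> dominance_le mu lam -> pi mu.

Definition weyl_orbits (pi : set (rd_X D)) : set (rd_X D) :=
  [set mu | exists w lam, [/\ weyl w, pi lam & mu = w lam]].

End Weights.

Section RationalTensor.

Variable Y : zmodType.

Inductive tens_term :=
| TensPure of rat & Y
| TensZero
| TensOpp of tens_term
| TensAdd of tens_term & tens_term.

(* The abelian group generated by the [q (x) y] subject to biadditivity; over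
   Z, balancedness is a consequence of biadditivity. *)
Inductive tens_cong : tens_term -> tens_term -> Prop :=
| tc_refl u : tens_cong u u
| tc_sym u v : tens_cong u v -> tens_cong v u
| tc_trans u v w : tens_cong u v -> tens_cong v w -> tens_cong u w
| tc_opp u v : tens_cong u v -> tens_cong (TensOpp u) (TensOpp v)
| tc_add u u' v v' : tens_cong u u' -> tens_cong v v' ->
    tens_cong (TensAdd u v) (TensAdd u' v')
| tc_addA u v w :
    tens_cong (TensAdd u (TensAdd v w)) (TensAdd (TensAdd u v) w)
| tc_addC u v : tens_cong (TensAdd u v) (TensAdd v u)
| tc_add0 u : tens_cong (TensAdd TensZero u) u
| tc_addN u : tens_cong (TensAdd (TensOpp u) u) TensZero
| tc_pureDl q q' y :
    tens_cong (TensPure (q + q') y) (TensAdd (TensPure q y) (TensPure q' y))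
| tc_pureDr q y y' :
    tens_cong (TensPure q (y + y')) (TensAdd (TensPure q y) (TensPure q y')).

HB.instance Definition _ := gen_eqMixin tens_term.
HB.instance Definition _ := gen_choiceMixin tens_term.

Lemma tens_cong_equiv : equiv_class_of (fun u v => `[< tens_cong u v >]).
Proof.
split=> [u|u v|v u w].
- by apply/asboolP; apply: tc_refl.
- by apply/asboolP/asboolP; apply: tc_sym.
- by move=> /asboolP uv /asboolP vw; apply/asboolP; apply: tc_trans uv vw.
Qed.

Canonical tens_equiv := EquivRelPack tens_cong_equiv.

Definition rat_tensor := {eq_quot tens_equiv}.

HB.instance Definition _ := Choice.on rat_tensor.
HB.instance Definition _ := EqQuotient.on rat_tensor.

Lemma tens_eqP u v : \pi_rat_tensor u = \pi_rat_tensor v <-> tens_cong u v.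
Proof.
split=> [/eqP|uv]; first by rewrite eqmodE => /asboolP.
by apply/eqP; rewrite eqmodE; apply/asboolP.
Qed.

Lemma tens_reprK u : tens_cong (repr (\pi_rat_tensor u)) u.
Proof. by apply/tens_eqP; rewrite reprK. Qed.

Definition tens q y : rat_tensor := \pi_rat_tensor (TensPure q y).
Definition tens_zero : rat_tensor := \pi_rat_tensor TensZero.
Definition tens_opp (u : rat_tensor) : rat_tensor :=
  \pi_rat_tensor (TensOpp (repr u)).
Definition tens_add (u v : rat_tensor) : rat_tensor :=
  \pi_rat_tensor (TensAdd (repr u) (repr v)).

Lemma tens_oppE u : tens_opp (\pi_rat_tensor u) = \pi_rat_tensor (TensOpp u).
Proof. by apply/tens_eqP; apply/tc_opp/tens_reprK. Qed.

Lemma tens_addE u v :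
  tens_add (\pi_rat_tensor u) (\pi_rat_tensor v) = \pi_rat_tensor (TensAdd u v).
Proof. by apply/tens_eqP; apply: tc_add; apply: tens_reprK. Qed.

Lemma tens_addA : associative tens_add.
Proof.
elim/quotW=> u; elim/quotW=> v; elim/quotW=> w.
by rewrite (tens_addE v w) (tens_addE u v) !tens_addE; apply/tens_eqP/tc_addA.
Qed.

Lemma tens_addC : commutative tens_add.
Proof.
elim/quotW=> u; elim/quotW=> v.
by rewrite !tens_addE; apply/tens_eqP; apply: tc_addC.
Qed.

Lemma tens_add0 : left_id tens_zero tens_add.
Proof. by elim/quotW=> u; rewrite tens_addE; apply/tens_eqP/tc_add0. Qed.

Lemma tens_addN : left_inverse tens_zero tens_opp tens_add.
Proof.
by elim/quotW=> u; rewrite (tens_oppE u) tens_addE; apply/tens_eqP/tc_addN.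
Qed.

HB.instance Definition _ := GRing.isZmodule.Build rat_tensor
  tens_addA tens_addC tens_add0 tens_addN.

Lemma tensDl q q' y : tens (q + q') y = tens q y + tens q' y.
Proof. by rewrite [RHS]tens_addE; apply/tens_eqP/tc_pureDl. Qed.

Lemma tensDr q y y' : tens q (y + y') = tens q y + tens q y'.
Proof. by rewrite [RHS]tens_addE; apply/tens_eqP/tc_pureDr. Qed.

Section Lift.

Variables (A : zmodType) (f : rat -> Y -> A).
Hypothesis fDl : forall q q' y, f (q + q') y = f q y + f q' y.
Hypothesis fDr : forall q y y', f q (y + y') = f q y + f q y'.

Fixpoint tens_eval (u : tens_term) : A :=
  match u with
  | TensPure q y => f q y
  | TensZero => 0
  | TensOpp u => - tens_eval u
  | TensAdd u v => tens_eval u + tens_eval v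
  end.

Lemma tens_eval_cong u v : tens_cong u v -> tens_eval u = tens_eval v.
Proof.
elim=> //= {u v}.
- by move=> u v w _ -> _ ->.
- by move=> u v _ ->.
- by move=> u u' v v' _ -> _ ->.
- by move=> u v w; rewrite addrA.
- by move=> u v; rewrite addrC.
- by move=> u; rewrite add0r.
- by move=> u; rewrite addNr.
Qed.

End Lift.

Definition tens_lift (A : zmodType) (f : rat -> Y -> A) (u : rat_tensor) : A :=
  tens_eval f (repr u).

Lemma tens_liftE (A : zmodType) (f : rat -> Y -> A) u :
  (forall q q' y, f (q + q') y = f q y + f q' y) ->
  (forall q y y', f q (y + y') = f q y + f q y') ->
  tens_lift f (\pi_rat_tensor u) = tens_eval f u.
Proof.
by move=> fDl fDr; apply: (tens_eval_cong fDl fDr); apply: tens_reprK.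
Qed.

Lemma tens_liftD (A : zmodType) (f : rat -> Y -> A) :
  (forall q q' y, f (q + q') y = f q y + f q' y) ->
  (forall q y y', f q (y + y') = f q y + f q y') ->
  {morph tens_lift f : u v / u + v}.
Proof.
move=> fDl fDr; elim/quotW=> u; elim/quotW=> v.
by rewrite [X in tens_lift f X]tens_addE !tens_liftE.
Qed.

Lemma tens_lift_pure (A : zmodType) (f : rat -> Y -> A) q y :
  (forall q q' y, f (q + q') y = f q y + f q' y) ->
  (forall q y y', f q (y + y') = f q y + f q y') ->
  tens_lift f (tens q y) = f q y.
Proof. by move=> fDl fDr; rewrite tens_liftE. Qed.

Lemma tens_ind (P : rat_tensor -> Prop) :
  (forall q y, P (tens q y)) -> P 0 -> (forall u, P u -> P (- u)) ->
  (forall u v, P u -> P v -> P (u + v)) -> forall u, P u.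
Proof.
move=> Pt P0 PN PD; elim/quotW; elim=> [q y||u Pu|u Pu v Pv].
- exact: Pt.
- exact: P0.
- by rewrite -tens_oppE; apply: PN.
- by rewrite -tens_addE; apply: PD.
Qed.

Definition tens_scale (a : rat) : rat_tensor -> rat_tensor :=
  tens_lift (fun q y => tens (a * q) y).

Lemma tens_scale_pure a q y : tens_scale a (tens q y) = tens (a * q) y.
Proof.
by rewrite /tens_scale tens_lift_pure // => *; rewrite ?mulrDr (tensDl, tensDr).
Qed.

Lemma tens_scaleD a : {morph tens_scale a : u v / u + v}.
Proof.
by apply: tens_liftD => *; rewrite ?mulrDr (tensDl, tensDr).
Qed.

Lemma tens_scale0 a : tens_scale a 0 = 0.
Proof. by apply: (addrI (tens_scale a 0)); rewrite -tens_scaleD !addr0. Qed.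

Lemma tens_scaleN a : {morph tens_scale a : u / - u}.
Proof.
move=> u; apply: (addrI (tens_scale a u)).
by rewrite -tens_scaleD !subrr tens_scale0.
Qed.

Lemma tens_scaleA a b u : tens_scale a (tens_scale b u) = tens_scale (a * b) u.
Proof.
elim/tens_ind: u => [q y||u IH|u v IHu IHv].
- by rewrite !tens_scale_pure mulrA.
- by rewrite !tens_scale0.
- by rewrite !tens_scaleN IH.
- by rewrite !tens_scaleD IHu IHv.
Qed.

Lemma tens_scale1 : left_id 1 tens_scale.
Proof.
elim/tens_ind=> [q y||u IH|u v IHu IHv].
- by rewrite !tens_scale_pure mul1r.
- by rewrite !tens_scale0.
- by rewrite !tens_scaleN IH.
- by rewrite !tens_scaleD IHu IHv.
Qed.

Lemma tens_scaleDl u : {morph tens_scale^~ u : a b / a + b}.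
Proof.
move=> a b; elim/tens_ind: u => [q y||u IH|u v IHu IHv].
- by rewrite !tens_scale_pure mulrDl tensDl.
- by rewrite !tens_scale0 addr0.
- by rewrite !tens_scaleN IH opprD.
- by rewrite !tens_scaleD IHu IHv addrACA.
Qed.

HB.instance Definition _ := GRing.Zmodule_isLmodule.Build rat rat_tensor
  tens_scaleA tens_scale1 tens_scaleD tens_scaleDl.

Lemma tensZ a q y : a *: tens q y = tens (a * q) y.
Proof. exact: tens_scale_pure. Qed.

End RationalTensor.

(* No associativity, commutativity or unit is built in: [palg R] is the free
   Q-vector space with a bilinear product on the type [G], modulo the ideal
   generated by the relations [R]. *)

Section PresentedAlgebra.

Variable G : Type.

Inductive alg_term :=
| AGen of G
| AZero
| AOpp of alg_term
| AAdd of alg_term & alg_term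
| AScale of rat & alg_term
| AMul of alg_term & alg_term.

HB.instance Definition _ := gen_eqMixin alg_term.
HB.instance Definition _ := gen_choiceMixin alg_term.

Section Eval.

Variables (A : lmodType rat) (mulA : A -> A -> A) (gen : G -> A).

Fixpoint alg_eval (u : alg_term) : A :=
  match u with
  | AGen g => gen g
  | AZero => 0
  | AOpp u => - alg_eval u
  | AAdd u v => alg_eval u + alg_eval v
  | AScale a u => a *: alg_eval u
  | AMul u v => mulA (alg_eval u) (alg_eval v)
  end.

End Eval.

Variable R : alg_term -> alg_term -> Prop.

Inductive alg_cong : alg_term -> alg_term -> Prop :=
| ac_rel u v : R u v -> alg_cong u v
| ac_refl u : alg_cong u u
| ac_sym u v : alg_cong u v -> alg_cong v u
| ac_trans u v w : alg_cong u v -> alg_cong v w -> alg_cong u w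
| ac_opp u v : alg_cong u v -> alg_cong (AOpp u) (AOpp v)
| ac_add u u' v v' : alg_cong u u' -> alg_cong v v' ->
    alg_cong (AAdd u v) (AAdd u' v')
| ac_scale a u v : alg_cong u v -> alg_cong (AScale a u) (AScale a v)
| ac_mul u u' v v' : alg_cong u u' -> alg_cong v v' ->
    alg_cong (AMul u v) (AMul u' v')
| ac_addA u v w : alg_cong (AAdd u (AAdd v w)) (AAdd (AAdd u v) w)
| ac_addC u v : alg_cong (AAdd u v) (AAdd v u)
| ac_add0 u : alg_cong (AAdd AZero u) u
| ac_addN u : alg_cong (AAdd (AOpp u) u) AZero
| ac_scaleA a b u : alg_cong (AScale a (AScale b u)) (AScale (a * b) u)
| ac_scale1 u : alg_cong (AScale 1 u) u
| ac_scaleDr a u v :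
    alg_cong (AScale a (AAdd u v)) (AAdd (AScale a u) (AScale a v))
| ac_scaleDl a b u :
    alg_cong (AScale (a + b) u) (AAdd (AScale a u) (AScale b u))
| ac_mulDl u v w : alg_cong (AMul (AAdd u v) w) (AAdd (AMul u w) (AMul v w))
| ac_mulDr u v w : alg_cong (AMul u (AAdd v w)) (AAdd (AMul u v) (AMul u w))
| ac_mulZl a u v : alg_cong (AMul (AScale a u) v) (AScale a (AMul u v))
| ac_mulZr a u v : alg_cong (AMul u (AScale a v)) (AScale a (AMul u v)).

Lemma alg_cong_equiv : equiv_class_of (fun u v => `[< alg_cong u v >]).
Proof.
split=> [u|u v|v u w].
- by apply/asboolP; apply: ac_refl.
- by apply/asboolP/asboolP; apply: ac_sym.
- by move=> /asboolP uv /asboolP vw; apply/asboolP; apply: ac_trans uv vw.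
Qed.

Canonical alg_equiv := EquivRelPack alg_cong_equiv.

Definition palg := {eq_quot alg_equiv}.

HB.instance Definition _ := Choice.on palg.
HB.instance Definition _ := EqQuotient.on palg.

Lemma palg_eqP u v : \pi_palg u = \pi_palg v <-> alg_cong u v.
Proof.
split=> [/eqP|uv]; first by rewrite eqmodE => /asboolP.
by apply/eqP; rewrite eqmodE; apply/asboolP.
Qed.

Lemma palg_reprK u : alg_cong (repr (\pi_palg u)) u.
Proof. by apply/palg_eqP; rewrite reprK. Qed.

Definition pgen g : palg := \pi_palg (AGen g).
Definition pzero : palg := \pi_palg AZero.
Definition popp (u : palg) : palg := \pi_palg (AOpp (repr u)).
Definition padd (u v : palg) : palg := \pi_palg (AAdd (repr u) (repr v)).
Definition pscale a (u : palg) : palg := \pi_palg (AScale a (repr u)).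
Definition pmul (u v : palg) : palg := \pi_palg (AMul (repr u) (repr v)).

Lemma poppE u : popp (\pi_palg u) = \pi_palg (AOpp u).
Proof. by apply/palg_eqP; apply/ac_opp/palg_reprK. Qed.

Lemma paddE u v : padd (\pi_palg u) (\pi_palg v) = \pi_palg (AAdd u v).
Proof. by apply/palg_eqP; apply: ac_add; apply: palg_reprK. Qed.

Lemma pscaleE a u : pscale a (\pi_palg u) = \pi_palg (AScale a u).
Proof. by apply/palg_eqP; apply/ac_scale/palg_reprK. Qed.

Lemma pmulE u v : pmul (\pi_palg u) (\pi_palg v) = \pi_palg (AMul u v).
Proof. by apply/palg_eqP; apply: ac_mul; apply: palg_reprK. Qed.

Lemma paddA : associative padd.
Proof.
elim/quotW=> u; elim/quotW=> v; elim/quotW=> w.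
by rewrite (paddE v w) (paddE u v) !paddE; apply/palg_eqP/ac_addA.
Qed.

Lemma paddC : commutative padd.
Proof.
by elim/quotW=> u; elim/quotW=> v; rewrite !paddE; apply/palg_eqP/ac_addC.
Qed.

Lemma padd0 : left_id pzero padd.
Proof. by elim/quotW=> u; rewrite paddE; apply/palg_eqP/ac_add0. Qed.

Lemma paddN : left_inverse pzero popp padd.
Proof. by elim/quotW=> u; rewrite (poppE u) paddE; apply/palg_eqP/ac_addN. Qed.

HB.instance Definition _ := GRing.isZmodule.Build palg paddA paddC padd0 paddN.

Lemma pscaleA a b u : pscale a (pscale b u) = pscale (a * b) u.
Proof.
by elim/quotW: u => u; rewrite (pscaleE b) !pscaleE; apply/palg_eqP/ac_scaleA.
Qed.

Lemma pscale1 : left_id 1 pscale.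
Proof. by elim/quotW=> u; rewrite pscaleE; apply/palg_eqP/ac_scale1. Qed.

Lemma pscaleDr : right_distributive pscale +%R.
Proof.
move=> a; elim/quotW=> u; elim/quotW=> v.
by rewrite [u in pscale a u]paddE !pscaleE [RHS]paddE;
  apply/palg_eqP/ac_scaleDr.
Qed.

Lemma pscaleDl u : {morph pscale^~ u : a b / a + b}.
Proof.
move=> a b; elim/quotW: u => u.
by rewrite !pscaleE [RHS]paddE; apply/palg_eqP/ac_scaleDl.
Qed.

HB.instance Definition _ := GRing.Zmodule_isLmodule.Build rat palg
  pscaleA pscale1 pscaleDr pscaleDl.

Lemma palg_addE u v : \pi_palg u + \pi_palg v = \pi_palg (AAdd u v).
Proof. exact: paddE. Qed.

Lemma palg_scaleE a u : a *: \pi_palg u = \pi_palg (AScale a u).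
Proof. exact: pscaleE. Qed.

Lemma palg_oppE u : - \pi_palg u = \pi_palg (AOpp u).
Proof. exact: poppE. Qed.

Lemma pmulDl : left_distributive pmul +%R.
Proof.
elim/quotW=> u; elim/quotW=> v; elim/quotW=> w.
by rewrite (palg_addE u v) !pmulE palg_addE; apply/palg_eqP/ac_mulDl.
Qed.

Lemma pmulDr : right_distributive pmul +%R.
Proof.
elim/quotW=> u; elim/quotW=> v; elim/quotW=> w.
by rewrite (palg_addE v w) !pmulE palg_addE; apply/palg_eqP/ac_mulDr.
Qed.

Lemma pmulZl a u v : pmul (a *: u) v = a *: pmul u v.
Proof.
elim/quotW: u => u; elim/quotW: v => v.
by rewrite (palg_scaleE a u) !pmulE palg_scaleE; apply/palg_eqP/ac_mulZl.
Qed.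

Lemma pmulZr a u v : pmul u (a *: v) = a *: pmul u v.
Proof.
elim/quotW: u => u; elim/quotW: v => v.
by rewrite (palg_scaleE a v) !pmulE palg_scaleE; apply/palg_eqP/ac_mulZr.
Qed.

End PresentedAlgebra.

Arguments AZero {G}.

Lemma alg_eval_cong (G : Type) (R : alg_term G -> alg_term G -> Prop)
    (A : lmodType rat) (mulA : A -> A -> A) (gen : G -> A) :
  left_distributive mulA +%R -> right_distributive mulA +%R ->
  (forall a u v, mulA (a *: u) v = a *: mulA u v) ->
  (forall a u v, mulA u (a *: v) = a *: mulA u v) ->
  (forall u v, R u v -> alg_eval mulA gen u = alg_eval mulA gen v) ->
  forall u v, alg_cong R u v -> alg_eval mulA gen u = alg_eval mulA gen v.
Proof.
move=> mDl mDr mZl mZr evR u v; elim=> //= {u v}.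
- by move=> u v w _ -> _ ->.
- by move=> u v _ ->.
- by move=> u u' v v' _ -> _ ->.
- by move=> a u v _ ->.
- by move=> u u' v v' _ -> _ ->.
- by move=> u v w; rewrite addrA.
- by move=> u v; rewrite addrC.
- by move=> u; rewrite add0r.
- by move=> u; rewrite addNr.
- by move=> a b u; rewrite scalerA.
- by move=> u; rewrite scale1r.
- by move=> a u v; rewrite scalerDr.
- by move=> a b u; rewrite scalerDl.
Qed.

HB.mixin Record Lmodule_isLie (K : pzRingType) L of GRing.Lmodule K L := {
  lie_br : L -> L -> L;
  lie_brDl : left_distributive lie_br +%R;
  lie_brDr : right_distributive lie_br +%R;
  lie_brZl : forall a x y, lie_br (a *: x) y = a *: lie_br x y;
  lie_brZr : forall a x y, lie_br x (a *: y) = a *: lie_br x y;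
  lie_brxx : forall x, lie_br x x = 0;
  lie_jacobi : forall x y z,
    lie_br x (lie_br y z) + lie_br y (lie_br z x) + lie_br z (lie_br x y) = 0
}.

#[short(type="lieAlgType")]
HB.structure Definition LieAlg (K : pzRingType) :=
  {L of GRing.Lmodule K L & Lmodule_isLie K L}.

Section PresentedLie.

Variables (G : Type) (R : alg_term G -> alg_term G -> Prop).

Inductive lie_rel : alg_term G -> alg_term G -> Prop :=
| lr_rel x y : R x y -> lie_rel x y
| lr_alt x : lie_rel (AMul x x) AZero
| lr_jacobi x y z :
    lie_rel (AAdd (AAdd (AMul x (AMul y z)) (AMul y (AMul z x)))
                  (AMul z (AMul x y))) AZero.

Definition presented_lie := palg lie_rel.

HB.instance Definition _ := GRing.Lmodule.on presented_lie.

Lemma plie_alt (x : presented_lie) : pmul x x = 0.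
Proof.
by elim/quotW: x => x; rewrite pmulE; apply/palg_eqP/ac_rel/lr_alt.
Qed.

Lemma plie_jacobi (x y z : presented_lie) :
  pmul x (pmul y z) + pmul y (pmul z x) + pmul z (pmul x y) = 0.
Proof.
elim/quotW: x => x; elim/quotW: y => y; elim/quotW: z => z.
rewrite (pmulE _ y z) (pmulE _ z x) (pmulE _ x y) !pmulE.
by rewrite (palg_addE _ (AMul x _)) palg_addE; apply/palg_eqP/ac_rel/lr_jacobi.
Qed.

HB.instance Definition _ := Lmodule_isLie.Build rat presented_lie
  (@pmulDl _ lie_rel) (@pmulDr _ lie_rel)
  (@pmulZl _ lie_rel) (@pmulZr _ lie_rel) plie_alt plie_jacobi.

Definition plie_gen (g : G) : presented_lie := pgen lie_rel g.

End PresentedLie.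

Section Enveloping.

Variable L : lieAlgType rat.

Let one : alg_term (option L) := AGen None.
Let inj (x : L) : alg_term (option L) := AGen (Some x).

(* The generator [None] becomes the unit. *)
Inductive env_rel : alg_term (option L) -> alg_term (option L) -> Prop :=
| er_mulA u v w : env_rel (AMul u (AMul v w)) (AMul (AMul u v) w)
| er_mul1r u : env_rel (AMul one u) u
| er_mulr1 u : env_rel (AMul u one) u
| er_injD x y : env_rel (inj (x + y)) (AAdd (inj x) (inj y))
| er_injZ a x : env_rel (inj (a *: x)) (AScale a (inj x))
| er_inj_br x y :
    env_rel (inj (lie_br x y))
      (AAdd (AMul (inj x) (inj y)) (AOpp (AMul (inj y) (inj x)))).

Definition enveloping := palg env_rel.

HB.instance Definition _ := GRing.Lmodule.on enveloping.

Definition env_one : enveloping := pgen env_rel None.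

Lemma env_mulA : associative (@pmul _ env_rel).
Proof.
elim/quotW=> u; elim/quotW=> v; elim/quotW=> w.
by rewrite (pmulE _ v w) (pmulE _ u v) !pmulE; apply/palg_eqP/ac_rel/er_mulA.
Qed.

Lemma env_mul1r : left_id env_one (@pmul _ env_rel).
Proof.
by elim/quotW=> u; rewrite [LHS]pmulE; apply/palg_eqP/ac_rel/er_mul1r.
Qed.

Lemma env_mulr1 : right_id env_one (@pmul _ env_rel).
Proof.
by elim/quotW=> u; rewrite [LHS]pmulE; apply/palg_eqP/ac_rel/er_mulr1.
Qed.

Lemma env_one_neq0 : env_one != 0.
Proof.
apply/eqP => /palg_eqP.
pose gen (o : option L) : rat^o := if o is Some _ then 0 else 1.
have /[apply] := @alg_eval_cong _ env_rel rat^o (fun x y => x * y) gen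
  (@mulrDl _) (@mulrDr _) (fun a u v => esym (scalerAl a u v))
  (fun a u v => esym (scalerAr a u v)).
rewrite /=; suff evR u v : env_rel u v ->
    alg_eval (A := rat^o) (fun x y => x * y) gen u
    = alg_eval (fun x y => x * y) gen v.
  by move=> /(_ evR) /eqP; rewrite oner_eq0.
case=> //= {u v}.
- by move=> u v w; rewrite mulrA.
- by move=> u; rewrite mul1r.
- by move=> u; rewrite mulr1.
- by move=> a _; rewrite scaler0.
Qed.

HB.instance Definition _ := GRing.Zmodule_isNzRing.Build enveloping
  env_mulA env_mul1r env_mulr1 (@pmulDl _ env_rel) (@pmulDr _ env_rel)
  env_one_neq0.

HB.instance Definition _ := GRing.Lmodule_isLalgebra.Build rat enveloping
  (fun a u v => esym (@pmulZl _ env_rel a u v)).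

HB.instance Definition _ := GRing.Lalgebra_isAlgebra.Build rat enveloping
  (fun a u v => esym (@pmulZr _ env_rel a u v)).

Definition env_inj (x : L) : enveloping := pgen env_rel (Some x).

Lemma env_inj_linear : linear env_inj.
Proof.
move=> a x y; rewrite /env_inj /pgen (palg_scaleE _ a (inj x)) palg_addE.
apply/palg_eqP.
by apply: ac_trans (ac_rel (er_injD _ _)) _; apply: ac_add (ac_refl _ _);
  apply/ac_rel/er_injZ.
Qed.

Lemma env_inj_br x y :
  env_inj (lie_br x y) = env_inj x * env_inj y - env_inj y * env_inj x.
Proof.
rewrite /env_inj /pgen [X in _ = X - _](pmulE _ (inj x)).
rewrite [X in _ = _ - X](pmulE _ (inj y)) palg_oppE palg_addE.
apply/palg_eqP; exact/ac_rel/er_inj_br.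
Qed.

End Enveloping.

Section RootDatumAlgebras.

Variable D : root_datum.

Definition cartan := rat_tensor (rd_Y D).
HB.instance Definition _ := GRing.Lmodule.on cartan.

Definition cartan_coroot (i : D) : cartan := tens 1 (rd_coroot i).

Definition cartan_pair (h : cartan) (lam : rd_X D) : rat :=
  tens_lift (fun q y => q * (rd_pair y lam)%:Q) h.

Lemma cartan_pair_tens q y lam :
  cartan_pair (tens q y) lam = q * (rd_pair y lam)%:Q.
Proof.
by rewrite /cartan_pair tens_lift_pure // => *;
  rewrite ?mulrDl // rd_pairDl rmorphD mulrDr.
Qed.

Lemma cartan_pairD lam : {morph cartan_pair^~ lam : h h' / h + h'}.
Proof.
by apply: tens_liftD => *; rewrite ?mulrDl // rd_pairDl rmorphD mulrDr.
Qed.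

Lemma cartan_pairZ a h lam : cartan_pair (a *: h) lam = a * cartan_pair h lam.
Proof.
have pair0 : cartan_pair 0 lam = 0.
  by apply: (addrI (cartan_pair 0 lam)); rewrite -cartan_pairD !addr0.
have pairN u : cartan_pair (- u) lam = - cartan_pair u lam.
  by apply: (addrI (cartan_pair u lam)); rewrite -cartan_pairD !subrr.
elim/tens_ind: h => [q y||u IH|u v IHu IHv].
- by rewrite tensZ !cartan_pair_tens mulrA.
- by rewrite scaler0 pair0 mulr0.
- by rewrite scalerN !pairN IH mulrN.
- by rewrite scalerDr !cartan_pairD IHu IHv mulrDr.
Qed.

Inductive g_gen := GenH of cartan | GenE of D | GenF of D.

Let H h : alg_term g_gen := AGen (GenH h).
Let E i : alg_term g_gen := AGen (GenE i).
Let F i : alg_term g_gen := AGen (GenF i).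

(* In the Serre relations the exponent [1 - <h_i, alpha_j>] is a positive
   integer, so the absolute value is a mere conversion to [nat]. *)
Definition serre_exp (i j : D) : nat :=
  `|1 - rd_pair (rd_coroot i) (rd_root j)|%N.

Inductive g_rel : alg_term g_gen -> alg_term g_gen -> Prop :=
| gr_HD h h' : g_rel (H (h + h')) (AAdd (H h) (H h'))
| gr_HZ a h : g_rel (H (a *: h)) (AScale a (H h))
| gr_HH h h' : g_rel (AMul (H h) (H h')) AZero
| gr_HE h i :
    g_rel (AMul (H h) (E i)) (AScale (cartan_pair h (rd_root i)) (E i))
| gr_HF h i :
    g_rel (AMul (H h) (F i)) (AScale (- cartan_pair h (rd_root i)) (F i))
| gr_EF_eq i : g_rel (AMul (E i) (F i)) (H (cartan_coroot i))
| gr_EF_neq i j : i != j -> g_rel (AMul (E i) (F j)) AZero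
| gr_serreE i j : i != j ->
    g_rel (iter (serre_exp i j) (AMul (E i)) (E j)) AZero
| gr_serreF i j : i != j ->
    g_rel (iter (serre_exp i j) (AMul (F i)) (F j)) AZero.

Definition g_alg := presented_lie g_rel.
HB.instance Definition _ := LieAlg.on g_alg.

Definition U_alg := enveloping g_alg.
HB.instance Definition _ := GRing.Algebra.on U_alg.

Definition U_cartan (h : cartan) : U_alg :=
  env_inj (plie_gen g_rel (GenH h) : g_alg).

End RootDatumAlgebras.

Definition is_subalgebra (K : pzRingType) (A : algType K) (B : set A) : Prop :=
  [/\ B 1, forall (a : K) x, B x -> B (a *: x),
      forall x y, B x -> B y -> B (x + y)
    & forall x y, B x -> B y -> B (x * y)].

Definition two_sided_ideal (A : pzRingType) (J : set A) : Prop :=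
  [/\ J 0, forall x y, J x -> J y -> J (x + y),
      forall a x, J x -> J (a * x)
    & forall a x, J x -> J (x * a)].

Definition ideal_generated (A : pzRingType) (S : set A) : set A :=
  smallest (@two_sided_ideal A) S.

Definition is_direct_sum (T : choiceType) (P : set T) (V : zmodType)
    (W : T -> set V) : Prop :=
  (forall v, exists (s : seq T) (c : T -> V),
     [/\ uniq s, forall t, t \in s -> P t /\ W t (c t)
       & v = \sum_(t <- s) c t]) /\
  (forall (s : seq T) (c : T -> V), uniq s ->
     (forall t, t \in s -> P t /\ W t (c t)) ->
     \sum_(t <- s) c t = 0 -> forall t, t \in s -> c t = 0).

Section SchurAlgebra.

Variable D : root_datum.

Definition U0_alg : set (U_alg D) :=
  smallest (@is_subalgebra rat (U_alg D)) (range (@U_cartan D)).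

(* A U-module is a Q-vector space through the unit of U. *)
Definition weight_space (V : lmodType (U_alg D)) (lam : rd_X D) : set V :=
  [set m | forall h : cartan D,
     U_cartan h *: m = ((cartan_pair h lam)%:A : U_alg D) *: m].

Definition weight_module (V : lmodType (U_alg D)) : Prop :=
  is_direct_sum setT (@weight_space V).

Variable pi : set (rd_X D).

Definition in_C_pi (V : lmodType (U_alg D)) : Prop :=
  weight_module V /\ is_direct_sum (weyl_orbits pi) (@weight_space V).

Definition defining_ideal : set (U_alg D) :=
  [set u | forall V : lmodType (U_alg D), in_C_pi V ->
     forall m : V, u *: m = 0].

End SchurAlgebra.

Arguments U0_alg : clear implicits.

Definition is_basis (K : pzRingType) (V : lmodType K) (n : nat)
    (b : 'I_n -> V) : Prop :=
  forall v, exists! c : 'rV[K]_n, v = \sum_i c 0 i *: b i.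

Definition vanishing_ideal (n : nat) (P : set ('I_n -> rat)) :
    set {mpoly rat[n]} :=
  [set p | forall v, P v -> p.@[v] = 0].

Section Points.

Variables (D : root_datum) (n : nat) (H : 'I_n -> cartan D).

Definition weight_points (S : set (rd_X D)) : set ('I_n -> rat) :=
  [set (fun a => cartan_pair (H a) lam) | lam in S].

(* Substitution of the [H_a], which identifies [Q[H_1, ..., H_n]] with [U0]. *)
Definition poly_to_U (p : {mpoly rat[n]}) : U_alg D :=
  mmap (fun q : rat => q%:A) (fun a => U_cartan (H a)) p.

End Points.

(* Main.v *)
Require Import Defs.
From HB Require Import structures.
From mathcomp Require Import all_boot all_order all_algebra.
From mathcomp Require Import boolp classical_sets cardinality.
From mathcomp Require Import mpoly.
From mathcomp Require Import ring lra zify.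

(** Let [J] be the two-sided ideal generated by the polynomials in the [H_a]
    vanishing on the weights in [W pi], and [Lambda] the defining ideal.

    [J] lies in [Lambda]: on a vector of weight [lam], a polynomial in the
    commuting elements [H_a] acts by its value at the point of [lam]
    ([poly_weight_vector]), so the generators of [J] kill every weight space
    [V_lam] with [lam] in [W pi], hence every object of [C[pi]].

    [Lambda] lies in [J]: it suffices that the left module [U / J] belongs to
    [C[pi]], for then an element [u] of [Lambda] kills the class of 1, which
    says that [u] is in [J].  The set [W pi] is finite, and distinct weights
    give distinct points, so there are polynomials [e_lam] with value 1 at [lam]
    and 0 at the other points of [W pi].  Modulo [J] they satisfy
    [\sum_lam e_lam = 1] and [H_a e_lam = <H_a, lam> e_lam], because both
    differences vanish on [W pi].  Hence [x = \sum_lam e_lam x] writes any class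
    as a sum of weight vectors ([quotient_weight_decomposition]); the sum is
    direct because weight spaces for distinct weights are always independent
    ([weight_spaces_independent]).

    Finiteness of [W pi] is where finite type enters.  A point of the orbit of
    [lam] is [lam + \sum_i c_i alpha_i] with [c] integral, and invariance of the
    norm under [W] makes [c] satisfy the equation
    [(c, c) + \sum_i c_i <h_i, lam> (i, i) = 0]; positive definiteness leaves
    only finitely many integral solutions ([finite_weyl_orbit]). *)

Import Order.TTheory GRing.Theory Num.Theory.

Set Implicit Arguments.
Unset Strict Implicit.
Unset Printing Implicit Defensive.

Local Open Scope classical_set_scope.
Local Open Scope quotient_scope.
Local Open Scope ring_scope.

(** * The quotient of a ring by a generated ideal, as a left module *)

Section QuotientModule.

Variable A : nzRingType.

Lemma ideal_generated_ideal (S : set A) :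
  two_sided_ideal (ideal_generated S).
Proof.
split=> [|x y Jx Jy|a x Jx|a x Jx] I HI; have [[I0 ID IMl IMr] _] := HI.
- exact: I0.
- by apply: ID; [apply: Jx HI | apply: Jy HI].
- by apply: IMl; apply: Jx HI.
- by apply: IMr; apply: Jx HI.
Qed.

Variable S : set A.

(** The boolean form of membership, on which quotients of groups are built. *)
Definition in_ideal_generated : {pred A} := fun x => `[< ideal_generated S x >].

Lemma in_ideal_generatedP x :
  reflect (ideal_generated S x) (x \in in_ideal_generated).
Proof. exact: asboolP. Qed.

Lemma in_ideal_generated_zmod_closed : zmod_closed in_ideal_generated.
Proof.
have [J0 JD JMl _] := ideal_generated_ideal S.
split=> [|x y /in_ideal_generatedP Jx /in_ideal_generatedP Jy].
  exact/in_ideal_generatedP.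
by apply/in_ideal_generatedP; apply: JD Jx _; rewrite -mulN1r; apply: JMl.
Qed.

HB.instance Definition _ := GRing.isZmodClosed.Build A in_ideal_generated
  in_ideal_generated_zmod_closed.

Definition quotient_module := {ideal_quot in_ideal_generated}.
HB.instance Definition _ := GRing.Zmodule.on quotient_module.
HB.instance Definition _ := EqQuotient.on quotient_module.

Definition quotient_proj (x : A) : quotient_module :=
  \pi_{ideal_quot in_ideal_generated} x.

Lemma quotient_proj_eq x y :
  quotient_proj x = quotient_proj y <-> ideal_generated S (x - y).
Proof.
by split=> [/eqP|Jxy]; [rewrite -Quotient.idealrBE => /in_ideal_generatedP|
  apply/eqP; rewrite -Quotient.idealrBE; apply/in_ideal_generatedP].
Qed.

Lemma quotient_projD : {morph quotient_proj : x y / x + y}.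
Proof. exact: (@Quotient.pi_add A in_ideal_generated). Qed.

Lemma quotient_proj0 : quotient_proj 0 = 0.
Proof. by apply: (addrI (quotient_proj 0)); rewrite -quotient_projD !addr0. Qed.

Definition quotient_scale (a : A) (x : quotient_module) : quotient_module :=
  quotient_proj (a * repr x).

Lemma quotient_scaleE a x :
  quotient_scale a (quotient_proj x) = quotient_proj (a * x).
Proof.
apply/quotient_proj_eq; rewrite -mulrBr.
have [_ _ JMl _] := ideal_generated_ideal S; apply: JMl.
rewrite -quotient_proj_eq.
exact: reprK.
Qed.

Lemma quotient_projP (x : quotient_module) : exists y, x = quotient_proj y.
Proof. by exists (repr x); rewrite -[LHS]reprK. Qed.

Lemma quotient_scaleA a b x :
  quotient_scale a (quotient_scale b x) = quotient_scale (a * b) x.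
Proof. by have [y ->] := quotient_projP x; rewrite !quotient_scaleE mulrA. Qed.

Lemma quotient_scale1 : left_id 1 quotient_scale.
Proof.
by move=> x; have [y ->] := quotient_projP x; rewrite quotient_scaleE mul1r.
Qed.

Lemma quotient_scaleDr : right_distributive quotient_scale +%R.
Proof.
move=> a x y; have [x' ->] := quotient_projP x.
have [y' ->] := quotient_projP y.
by rewrite -quotient_projD !quotient_scaleE mulrDr quotient_projD.
Qed.

Lemma quotient_scaleDl x : {morph quotient_scale^~ x : a b / a + b}.
Proof.
move=> a b; have [y ->] := quotient_projP x.
by rewrite !quotient_scaleE mulrDl quotient_projD.
Qed.

HB.instance Definition _ := GRing.Zmodule_isLmodule.Build A quotient_module
  quotient_scaleA quotient_scale1 quotient_scaleDr quotient_scaleDl.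

Lemma quotient_projZ a x : a *: quotient_proj x = quotient_proj (a * x).
Proof. exact: quotient_scaleE. Qed.

End QuotientModule.

(** * Polynomials in commuting elements of an algebra *)

Section Evaluation.

Variables (A : algType rat) (n : nat) (h : 'I_n -> A).

Lemma eigenvectorM (V : lmodType A) (x : V) (a b : A) (c d : rat) :
  a *: x = c%:A *: x -> b *: x = d%:A *: x -> (a * b) *: x = (c * d)%:A *: x.
Proof.
move=> ax bx; rewrite -[LHS]scalerA bx scalerA (mulr_algr d a) -(mulr_algl d a).
by rewrite -[LHS]scalerA ax scalerA mulr_algl scalerA mulrC.
Qed.

Lemma mmap_eigenvector (V : lmodType A) (w : 'I_n -> rat) (x : V) :
  (forall i, h i *: x = (w i)%:A *: x) ->
  forall p, mmap (in_alg A) h p *: x = (p.@[w])%:A *: x.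
Proof.
move=> hx; elim/mpolyind => [|c m p _ _ IH]; first by rewrite !raddf0 !scale0r.
rewrite mmapD mevalD mmapZ mevalZ mmapX mevalX !scalerDl IH; congr (_ + _).
apply: eigenvectorM => //; rewrite /mmap1.
elim/big_rec2: _ => [|i a b _ IHb]; first by rewrite !scale1r.
apply: eigenvectorM => //; elim: (m i) => [|k IHk].
  by rewrite !expr0 !scale1r.
by rewrite !exprS; apply: eigenvectorM.
Qed.

Hypothesis hC : forall i j, GRing.comm (h i) (h j).

(** The elements [h i] commute only with each other, not with all of [A], so
    multiplicativity of evaluation is proved from pairwise commutation: moving
    [h i ^+ m2 i] past the remaining factors from [m1] is all that is used. *)
Lemma mmap1D_comm m1 m2 : mmap1 h (m1 + m2)%MM = mmap1 h m1 * mmap1 h m2.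
Proof.
rewrite /mmap1; pose K (x y z : A) := z = x * y /\ forall j, GRing.comm x (h j).
suff []: K (\prod_(i < n) h i ^+ m1 i) (\prod_(i < n) h i ^+ m2 i)
            (\prod_(i < n) h i ^+ (m1 + m2)%MM i) by [].
elim/big_rec3: _ => [|i x y z _ [-> xC]].
  by split=> [|j]; [rewrite mulr1 | apply: commr_sym; apply: commr1].
split=> [|j]; last first.
  apply: commr_sym; apply: commrM; last exact: commr_sym.
  exact/commrX/hC.
by rewrite mnmDE exprD -!mulrA; congr (_ * _); rewrite !mulrA (commrX _ (xC i)).
Qed.

Lemma mmapXM i p : mmap (in_alg A) h ('X_i * p) = h i * mmap (in_alg A) h p.
Proof.
elim/mpolyind: p => [|c m p _ _ IH]; first by rewrite mulr0 raddf0 mulr0.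
rewrite mulrDr !mmapD IH mulrDr; congr (_ + _).
rewrite -scalerAr -mpolyXD !mmapZ !mmapX mmap1D_comm mmap1U.
by rewrite !mulr_algl -scalerAr.
Qed.

End Evaluation.

(** Lagrange interpolation: for each [u] of [s] distinct from [t], multiply by
    an affine factor in a coordinate that separates the points of [t] and [u].
    Asking for the value at [t] even when [t] is not in [s] makes the induction
    on [s] go through. *)
Lemma interpolation (T : choiceType) (n : nat) (pt : T -> 'I_n -> rat) :
  (forall t u, pt t =1 pt u -> t = u) -> forall (s : seq T) t,
  exists p : {mpoly rat[n]},
    forall u, u \in t :: s -> p.@[pt u] = (u == t)%:R.
Proof.
move=> pt_inj s t; elim: s => [|u s [p pE]].
  by exists 1 => u; rewrite mem_seq1 => ->; rewrite meval1.
have [->|u't] := eqVneq u t.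
  by exists p => v; rewrite !inE orbA orbb -in_cons; apply: pE.
have [a neq_a] : exists a, pt t a - pt u a != 0.
  apply: contrapT => no_a; move/eqP: u't; apply; apply: pt_inj => a.
  apply: contrapT => /eqP neq_a; apply: no_a; exists a.
  by rewrite subr_eq0 eq_sym.
exists ((pt t a - pt u a)^-1 *: (('X_a - (pt u a)%:MP) * p)) => v.
rewrite mevalZ mevalM mevalB mevalXU mevalC !inE.
case: (eqVneq v u) => [-> _|v'u].
  by rewrite subrr mul0r mulr0 (negbTE u't).
rewrite -in_cons => /pE->.
by case: eqVneq => [->|_]; rewrite !(mulr0, mulr1, mulVf).
Qed.

(** * Finiteness of Weyl group orbits *)

Section PairingAdditive.

Variable D : root_datum.

Lemma rd_pair_zmod_morphism (y : rd_Y D) : zmod_morphism (rd_pair y).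
Proof.
move=> x x'; apply: (addIr (rd_pair y x')).
by rewrite -rd_pairDr !subrK.
Qed.

HB.instance Definition _ y := GRing.isZmodMorphism.Build (rd_X D) int
  (rd_pair y) (rd_pair_zmod_morphism y).

End PairingAdditive.

Lemma sum_delta_shift (I : finType) (x F : I -> rat) (r : rat) (k : I) :
  \sum_i (x i - r *+ (i == k)) * F i = \sum_i x i * F i - r * F k.
Proof.
rewrite (bigD1 k) //= [X in _ = X - _](bigD1 k) //= eqxx mulrBl addrAC.
by congr (_ + _ - _); apply: eq_bigr => i /negbTE ->; rewrite subr0.
Qed.

Section FiniteOrbits.

Variables (D : root_datum) (hD : cd_finite_type D).

Local Notation B i j := ((cd_form i j)%:Q).

(** A positive definite form is nondegenerate, so its Gram matrix is
    invertible. *)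
Lemma posdef_solve (b : D -> rat) :
  exists w : D -> rat, forall i, \sum_j B i j * w j = b i.
Proof.
pose M : 'M[rat]_#|D| := \matrix_(i, j) B (enum_val i) (enum_val j).
have sumE (F : D -> rat) : \sum_i F i = \sum_(i < #|D|) F (enum_val i).
  exact: (reindex _ (onW_bij _ (@enum_val_bij D))).
have M_unit : M \in unitmx.
  rewrite unitmxE unitfE; apply/negP => /det0P[v v0 vM].
  pose x (i : D) := v 0 (enum_rank i).
  have : 0 < \sum_i \sum_j x i * x j * B i j.
    apply: hD; apply: contrapT => x0; move/eqP: v0; apply; apply/rowP => i.
    rewrite mxE; apply: contrapT => /eqP vi; apply: x0; exists (enum_val i).
    by rewrite /x enum_valK.
  rewrite exchange_big big1 ?ltxx // => j _ /=.
  move/rowP/(_ (enum_rank j)): vM; rewrite !mxE => vMj.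
  transitivity (x j * \sum_k v 0 k * M k (enum_rank j)); last first.
    by rewrite vMj mulr0.
  rewrite mulr_sumr sumE; apply: eq_bigr => i _.
  by rewrite /x mxE enum_rankK enum_valK mulrAC mulrC mulrA.
have [w wE] : exists w, M *m w = \col_i b (enum_val i).
  exists (invmx M *m (\col_i b (enum_val i))).
  by rewrite mulmxA mulmxV // mul1mx.
exists (fun j => w (enum_rank j) 0) => i.
move/colP/(_ (enum_rank i)): wE; rewrite !mxE enum_rankK => <-; rewrite sumE.
by apply: eq_bigr => j _; rewrite mxE enum_rankK enum_valK.
Qed.

Lemma posdef_ge0 (x : D -> rat) : 0 <= \sum_i \sum_j x i * x j * B i j.
Proof.
have [/hD/ltW//|x0] := pselect (exists i, x i != 0).
rewrite big1 // => i _; rewrite big1 // => j _.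
suff ->: x i = 0 by rewrite !mul0r.
by apply: contrapT => /eqP xi; apply: x0; exists i.
Qed.

(** Positivity of the form at [x + w], where [w] is chosen so that the cross term
    is [\sum_i x i * b i - eps * x i], bounds [eps * x i] by the value of the
    form at [w]. *)
Lemma posdef_level_bounded (b : D -> rat) (i : D) :
  exists K : rat, forall x : D -> rat,
    \sum_i \sum_j x i * x j * B i j + \sum_i x i * b i = 0 -> `|x i| <= K.
Proof.
have bound (eps : rat) : exists K : rat, forall x : D -> rat,
    \sum_i \sum_j x i * x j * B i j + \sum_i x i * b i = 0 -> eps * x i <= K.
  have [w wE] := posdef_solve (fun j => (b j - eps *+ (j == i)) / 2).
  exists (\sum_i \sum_j w i * w j * B i j) => x x0.
  have := posdef_ge0 (fun j => x j + w j).
  have -> : \sum_i \sum_j (x i + w i) * (x j + w j) * B i j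
      = \sum_i \sum_j x i * x j * B i j + \sum_i \sum_j w i * w j * B i j
        + 2 * \sum_i x i * \sum_j B i j * w j.
    have -> : 2 * \sum_i x i * (\sum_j B i j * w j) =
        \sum_i \sum_j x i * w j * B i j + \sum_i \sum_j w i * x j * B i j.
      rewrite [X in _ = _ + X]exchange_big -big_split /= mulr_sumr.
      apply: eq_bigr => k _; rewrite -big_split mulr_sumr mulr_sumr /=.
      by apply: eq_bigr => l _; rewrite [cd_form l k]cd_formC; ring.
    rewrite -!big_split; apply: eq_bigr => k _ /=.
    by rewrite -!big_split; apply: eq_bigr => l _ /=; ring.
  have -> : 2 * \sum_i x i * (\sum_j B i j * w j)
      = \sum_i x i * b i - eps * x i.
    under [in RHS]eq_bigr => k _ do rewrite mulrC.
    rewrite -sum_delta_shift mulr_sumr; apply: eq_bigr => k _.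
    by rewrite wE; field.
  by lra.
(* The two signs of [eps] bound [x i] from above and from below. *)
have [K1 bK1] := bound 1; have [K2 bK2] := bound (-1).
exists (Num.max K1 K2) => x x0; rewrite ler_norml.
have le1 : K1 <= Num.max K1 K2 by rewrite le_max lexx.
have le2 : K2 <= Num.max K1 K2 by rewrite le_max lexx orbT.
by have := bK1 x x0; have := bK2 x x0 => x2 x1; apply/andP; split; lra.
Qed.

(** If [p] is the projection of [lam] to the rational span of the roots, the
    equation says that [p + c] has the same norm as [p]; in this form it is
    checked directly to be preserved by every simple reflection. *)
Lemma weyl_orbit_coordinates (lam : rd_X D) w : weyl w ->
  exists c : D -> int, w lam = lam + \sum_i rd_root i *~ c i /\
    \sum_i \sum_j (c i)%:Q * (c j)%:Q * B i j
      + \sum_i (c i)%:Q * ((rd_pair (rd_coroot i) lam)%:Q * B i i) = 0.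
Proof.
elim=> [|k {}w _ [c [wE c0]]].
  exists (fun=> 0); split.
    by rewrite big1 ?addr0 // => i _; rewrite mulr0z.
  rewrite !big1 ?addr0 // => i _; rewrite ?mul0r //.
  by rewrite big1 // => j _; rewrite !mul0r.
pose r := rd_pair (rd_coroot k) (w lam).
have Bkk : B k k != 0.
  by have [l ->] := cd_form_diag k; rewrite intr_eq0.
have rE : r%:Q * B k k = (rd_pair (rd_coroot k) lam)%:Q * B k k
    + 2 * \sum_j (c j)%:Q * B k j.
  rewrite /r wE raddfD raddf_sum intrD mulrDl rmorph_sum; congr (_ + _).
  rewrite mulr_suml mulr_sumr; apply: eq_bigr => j _ /=.
  rewrite raddfMz mulrzz intrM rd_pair_coroot_root; field; exact: Bkk.
exists (fun i => c i - r *+ (i == k)); split.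
  rewrite /= /rd_refl -/r wE -addrA; congr (_ + _).
  under [RHS]eq_bigr => i _ do rewrite mulrzBr.
  rewrite sumrB; congr (_ - _).
  rewrite (bigD1 k) //= eqxx big1 ?addr0 // => i /negbTE ->.
  by rewrite mulr0n mulr0z.
have cE i : (c i - r *+ (i == k))%:Q = (c i)%:Q - r%:Q *+ (i == k).
  by rewrite rmorphB rmorphMn.
have -> : \sum_i \sum_j
      (c i - r *+ (i == k))%:Q * (c j - r *+ (j == k))%:Q * B i j
    = \sum_i \sum_j (c i)%:Q * (c j)%:Q * B i j
      - 2 * r%:Q * (\sum_j (c j)%:Q * B k j) + r%:Q * (r%:Q * B k k).
  pose G i := \sum_j (c j)%:Q * B i j - r%:Q * B i k.
  transitivity (\sum_i ((c i)%:Q - r%:Q *+ (i == k)) * G i).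
    apply: eq_bigr => i _; rewrite /G -sum_delta_shift mulr_sumr.
    by apply: eq_bigr => j _; rewrite !cE mulrA.
  have -> : \sum_i \sum_j (c i)%:Q * (c j)%:Q * B i j
      = \sum_i (c i)%:Q * G i + r%:Q * \sum_j (c j)%:Q * B k j.
    rewrite mulr_sumr -big_split; apply: eq_bigr => i _ /=.
    rewrite /G mulrBr mulr_sumr [cd_form k i]cd_formC mulrCA subrK.
    by apply: eq_bigr => j _; rewrite mulrA.
  by rewrite sum_delta_shift /G; ring.
under [X in _ + X]eq_bigr => i _ do rewrite cE.
rewrite sum_delta_shift rE.
move: c0; set S0 := \sum_i \sum_j _; set S1 := \sum_i (_ * (_ * _)).
by move=> c0; rewrite -[RHS]c0; ring.
Qed.

Lemma finite_weyl_orbit (lam : rd_X D) :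
  finite_set [set mu | exists2 w, weyl w & mu = w lam].
Proof.
pose b (i : D) := (rd_pair (rd_coroot i) lam)%:Q * B i i.
have /choice[K KP] := posdef_level_bounded b.
have [N NP] : exists N : nat, forall i, K i <= N%:R.
  exists (\max_i Num.bound `|K i|)%N => i; apply: le_trans (ler_norm _) _.
  apply: le_trans (ltW (archi_boundP (normr_ge0 _))) _.
  by rewrite ler_nat; apply: leq_bigmax.
(* Integers between [- N] and [N] are encoded as ordinals shifted by [N]. *)
pose coord (d : {ffun D -> 'I_(N + N).+1}) : rd_X D :=
  lam + \sum_i rd_root i *~ ((d i : nat)%:Z - N%:Z).
apply: (@sub_finite_set _ _ (coord @` [set: {ffun D -> 'I_(N + N).+1}])).
  move=> mu [w /weyl_orbit_coordinates - /(_ lam)[c [-> c0]] ->].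
  exists [ffun i => inord (absz (c i + N%:Z))] => //.
  rewrite /coord; congr (_ + _); apply: eq_bigr => i _; congr (_ *~ _).
  have : `|c i| <= N%:Z.
    have := le_trans (KP i (fun j => (c j)%:Q) c0) (NP i).
    by rewrite -intr_norm -[N%:R]/(N%:Z%:~R) ler_int.
  by move=> cN; rewrite ffunE inordK; lia.
exact/finite_image/finite_finset.
Qed.

Lemma finite_weyl_orbits (pi : set (rd_X D)) :
  finite_set pi -> finite_set (weyl_orbits pi).
Proof.
move=> pi_fin; apply: sub_finite_set (bigcup_finite pi_fin _); last first.
  by move=> lam _; apply: finite_weyl_orbit.
by move=> mu [w [lam [Ww pi_lam ->]]]; exists lam => //; exists w.
Qed.

End FiniteOrbits.

(** * Weight vectors and the Cartan subalgebra *)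

HB.instance Definition _ (L : lieAlgType rat) :=
  GRing.isLinear.Build rat L (enveloping L) _ (@env_inj L) (@env_inj_linear L).

Section CartanSubalgebra.

Variable D : root_datum.

Lemma U_cartan_linear : linear (@U_cartan D).
Proof.
move=> a h h'; rewrite /U_cartan -env_inj_linear; congr env_inj.
rewrite /plie_gen /pgen palg_scaleE palg_addE; apply/palg_eqP.
apply: ac_trans (ac_rel (lr_rel (gr_HD _ _))) _.
by apply: ac_add (ac_refl _ _); apply/ac_rel/lr_rel/gr_HZ.
Qed.

HB.instance Definition _ := GRing.isLinear.Build rat (cartan D) (U_alg D) _
  (@U_cartan D) U_cartan_linear.

Lemma U_cartan_comm h h' : GRing.comm (@U_cartan D h) (@U_cartan D h').
Proof.
apply/eqP; rewrite -subr_eq0 /U_cartan -env_inj_br; apply/eqP.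
have -> : lie_br (plie_gen (@g_rel D) (GenH h) : g_alg D)
                 (plie_gen (@g_rel D) (GenH h') : g_alg D) = 0.
  by rewrite [LHS]pmulE; apply/palg_eqP/ac_rel/lr_rel/gr_HH.
exact: raddf0.
Qed.

Lemma cartan_pair_sum n (c : 'I_n -> rat) (H : 'I_n -> cartan D) lam :
  cartan_pair (\sum_i c i *: H i) lam = \sum_i c i * cartan_pair (H i) lam.
Proof.
elim/big_rec2: _ => [|i x h _ <-]; last by rewrite cartan_pairD cartan_pairZ.
by rewrite -(scale0r (0 : cartan D)) cartan_pairZ mul0r.
Qed.

(** Perfectness of the pairing: an element of [X] is determined by the linear
    form on [Y] that it defines. *)
Lemma rd_pair_inj (lam mu : rd_X D) :
  (forall y, rd_pair y lam = rd_pair y mu) -> lam = mu.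
Proof.
move=> eq_pair.
have pair_zmod : zmod_morphism (fun y : rd_Y D => rd_pair y mu).
  move=> y y'; apply: (addIr (rd_pair y' mu)).
  by rewrite -rd_pairDl !subrK.
pose phi : {additive rd_Y D -> int} := HB.pack (fun y : rd_Y D => rd_pair y mu)
  (GRing.isZmodMorphism.Build _ _ _ pair_zmod).
by have [x [_ x_uniq]] := rd_perfectr phi; rewrite -[lam]x_uniq // -[mu]x_uniq.
Qed.

Variables (n : nat) (H : 'I_n -> cartan D) (hH : is_basis H).

Definition weight_point (lam : rd_X D) : 'I_n -> rat :=
  fun a => cartan_pair (H a) lam.

(** The [H_a] span the Cartan subalgebra, so their values on a weight determine
    its values on all of [Y]. *)
Lemma weight_point_inj (lam mu : rd_X D) :
  weight_point lam =1 weight_point mu -> lam = mu.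
Proof.
move=> eq_pt; apply: rd_pair_inj => y.
have [c [yE _]] := hH (tens 1 y).
have : cartan_pair (tens 1 y) lam = cartan_pair (tens 1 y) mu.
  rewrite yE !cartan_pair_sum; apply: eq_bigr => a _.
  by congr (_ * _); apply: eq_pt.
by rewrite !cartan_pair_tens !mul1r => /eqP; rewrite eqr_int => /eqP.
Qed.

Lemma poly_to_UE p :
  poly_to_U H p = mmap (in_alg (U_alg D)) (fun a => U_cartan (H a)) p.
Proof. by []. Qed.

Lemma poly_to_U_in_U0 p : U0_alg D (poly_to_U H p).
Proof.
move=> B HB; have [[B1 BZ BD BM] B_range] := HB.
have B_H a : B (U_cartan (H a)).
  by apply: B_range; exists (H a).
rewrite poly_to_UE /mmap; elim/big_rec: _ => [|m x _ Bx].
  by rewrite -(scale0r 1); apply: BZ.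
apply: BD => //; apply: (BM); first exact: BZ.
rewrite /mmap1; elim/big_rec: _ => [|a y _ By] //; apply: (BM) => //.
by elim: (m a) => [|k IH]; rewrite ?expr0 // exprS; apply: (BM).
Qed.

Section Weights.

Variable V : lmodType (U_alg D).

Lemma weight_spaceP lam (x : V) :
  weight_space lam x <->
  forall a, U_cartan (H a) *: x = (weight_point lam a)%:A *: x.
Proof.
split=> [xlam a|xlam h]; first exact: xlam.
have [c [-> _]] := hH h; rewrite cartan_pair_sum raddf_sum !scaler_suml.
apply: eq_bigr => a _ /=; rewrite linearZ /= -(mulr_algl (c 0 a)).
by rewrite -[LHS]scalerA xlam scalerA mulr_algl scalerA.
Qed.

Lemma poly_weight_vector lam (x : V) p : weight_space lam x ->
  poly_to_U H p *: x = (p.@[weight_point lam])%:A *: x.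
Proof. by move=> /weight_spaceP xlam; exact: (mmap_eigenvector xlam). Qed.

(** In a vanishing sum of weight vectors, a polynomial that is 1 at the point of
    [t] and 0 at the other points extracts the component [c t]. *)
Lemma weight_spaces_independent (s : seq (rd_X D)) (c : rd_X D -> V) :
  uniq s -> (forall t, t \in s -> weight_space t (c t)) ->
  \sum_(t <- s) c t = 0 -> forall t, t \in s -> c t = 0.
Proof.
move=> s_uniq c_wt c0 t ts; have [p pE] := interpolation weight_point_inj s t.
rewrite -(scaler0 V (poly_to_U H p)) -c0 scaler_sumr (bigD1_seq t) //=.
rewrite (poly_weight_vector _ (c_wt t ts)) pE ?mem_head // eqxx !scale1r.
rewrite big_seq_cond big1 ?addr0 // => u /andP[us ut].
rewrite (poly_weight_vector _ (c_wt u us)) pE ?inE ?us ?orbT //.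
by rewrite (negbTE ut) !scale0r.
Qed.

End Weights.

End CartanSubalgebra.

(** * Weights of the quotient by a vanishing ideal *)

Section QuotientWeights.

Variables (D : root_datum) (n : nat) (H : 'I_n -> cartan D) (hH : is_basis H).
Variable P : set (rd_X D).

Local Notation S := (poly_to_U H @` vanishing_ideal (weight_points H P)).
Local Notation V := (quotient_module S).

Lemma poly_in_ideal p :
  (forall lam, P lam -> p.@[weight_point H lam] = 0) ->
  ideal_generated S (poly_to_U H p).
Proof.
move=> p0; apply: sub_gen_smallest; exists p => // v [lam Plam <-].
exact: p0.
Qed.

(** Modulo the ideal, the interpolation polynomials become a decomposition of 1
    into simultaneous eigenvectors of the [H_a] under left multiplication. *)
Lemma quotient_weight_decomposition : finite_set P ->
  is_direct_sum P (@weight_space D V).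
Proof.
move=> /finite_seqP[s' P_s'].
have [s s_uniq P_s] : exists2 s, uniq s & P = [set` s].
  exists (undup s'); rewrite ?undup_uniq // P_s'.
  by apply/seteqP; split=> x /=; rewrite mem_undup.
split; last first.
  move=> r c r_uniq c_wt; apply: (weight_spaces_independent hH) r_uniq _.
  by move=> t /c_wt[].
have /choice[e eE] := interpolation (weight_point_inj hH) s.
have [_ _ _ JMr] := ideal_generated_ideal S.
move=> v; have [x ->] := quotient_projP v.
exists s, (fun lam => quotient_proj S (poly_to_U H (e lam) * x)); split=> //.
  move=> lam lam_s; split; first by rewrite P_s.
  apply/(weight_spaceP hH) => a; rewrite !quotient_projZ.
  apply/quotient_proj_eq; rewrite !mulrA -mulrBl; apply: JMr.
  have -> : U_cartan (H a) * poly_to_U H (e lam)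
      - (weight_point H lam a)%:A * poly_to_U H (e lam)
      = poly_to_U H ('X_a * e lam - weight_point H lam a *: e lam).
    by rewrite !poly_to_UE mmapB mmapXM ?mmapZ // => i j; apply: U_cartan_comm.
  apply: poly_in_ideal => mu; rewrite P_s /= => mu_s.
  rewrite mevalB mevalM mevalXU mevalZ eE ?inE ?mu_s ?orbT // -mulrBl.
  by case: eqVneq => [->|_]; rewrite ?subrr ?mul0r ?mulr0.
have -> : \sum_(lam <- s) quotient_proj S (poly_to_U H (e lam) * x)
    = quotient_proj S (poly_to_U H (\sum_(lam <- s) e lam) * x).
  rewrite !poly_to_UE raddf_sum mulr_suml.
  elim/big_rec2: _ => [|lam y z _ ->]; last by rewrite quotient_projD.
  by rewrite quotient_proj0.
apply/quotient_proj_eq; rewrite -[X in X - _]mul1r -mulrBl; apply: JMr.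
have -> : 1 - poly_to_U H (\sum_(lam <- s) e lam)
    = poly_to_U H (1 - \sum_(lam <- s) e lam).
  by rewrite !poly_to_UE mmapB -mpolyC1 mmapC /= scale1r.
apply: poly_in_ideal => mu; rewrite P_s /= => mu_s.
rewrite mevalB meval1 (raddf_sum (meval _)) /= (bigD1_seq mu) //=.
rewrite eE ?mem_head // eqxx big1 ?addr0 ?subrr // => lam lam_mu.
by rewrite eE ?inE ?mu_s ?orbT // eq_sym (negbTE lam_mu).
Qed.

End QuotientWeights.

(** * The defining ideal *)

Lemma defining_ideal_ideal (D : root_datum) (pi : set (rd_X D)) :
  two_sided_ideal (defining_ideal pi).
Proof.
split=> [V _ m|x y x0 y0 V VC m|a x x0 V VC m|a x x0 V VC m].
- by rewrite scale0r.
- by rewrite scalerDl x0 ?y0 ?addr0.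
- by rewrite -scalerA x0 ?scaler0.
- by rewrite -scalerA x0.
Qed.

Theorem theorem5p3 (D : root_datum) (hD : cd_finite_type D)
    (pi : set (rd_X D)) (hfin : finite_set pi) (hsat : saturated pi)
    (n : nat) (H : 'I_n -> cartan D) (hH : is_basis H) :
  defining_ideal pi
    = ideal_generated
        (poly_to_U H @` vanishing_ideal (weight_points H (weyl_orbits pi)))
  /\ defining_ideal pi = ideal_generated (defining_ideal pi `&` U0_alg D).
Proof.
set S := poly_to_U H @` _.
have S_sub : S `<=` defining_ideal pi.
  move=> _ [p p0 <-] V [_ [V_sum _]] m.
  have [s [c [_ c_wt ->]]] := V_sum m.
  rewrite scaler_sumr big_seq big1 // => lam /c_wt[lam_pi c_lam].
  rewrite (poly_weight_vector hH _ c_lam) p0 ?scale0r //.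
  by exists lam.
have Lambda_gen : defining_ideal pi = ideal_generated S.
  apply/seteqP; split; last exact: smallest_sub (defining_ideal_ideal pi) S_sub.
  have W_sum := quotient_weight_decomposition hH (finite_weyl_orbits hD hfin).
  move=> u /(_ (quotient_module S)) u0.
  (* The decomposition indexed by [W pi] is also one indexed by all of [X]. *)
  have VC : in_C_pi pi (quotient_module S).
    split=> //; split=> [v|r c r_uniq c_wt].
      have [s [c [s_uniq c_wt ->]]] := W_sum.1 v.
      by exists s, c; split=> // t /c_wt[].
    by apply: (weight_spaces_independent hH) r_uniq _ => t /c_wt[].
  have := u0 VC (quotient_proj S 1); rewrite quotient_projZ mulr1.
  rewrite -quotient_proj0.
  by move/quotient_proj_eq; rewrite subr0.
split=> //; apply/seteqP; split; last first.
  by apply: smallest_sub (defining_ideal_ideal pi) _; apply: subIsetl.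
rewrite [X in X `<=` _]Lambda_gen; apply: smallest_sub.
  exact: ideal_generated_ideal.
move=> x Sx; apply: sub_gen_smallest; split; first exact: S_sub.
by have [p _ <-] := Sx; apply: poly_to_U_in_U0.
Qed.
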